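(* Let $(X,d)$ be an Atsuji space. Then for each decreasing sequence $\{K_n\}_{n\ge 1}$ of nonempty closed bounded subsets of $X$ with $\hat d(K_n)\to 0$ as $n\to\infty$, one has $\bigcap_{n=1}^{\infty} K_n\neq\emptyset$.
   Context: A metric space $(X,d)$ is an Atsuji space if the set $X'$ of limit (accumulation) points of $X$ is compact and, for each $\epsilon>0$, the complement in $X$ of $N_\epsilon(X'):=\bigcup_{x\in X'}B(x,\epsilon)$ is uniformly discrete (i.e. there is $\eta>0$ such that any two distinct points of it are at distance at least $\eta$); here $B(x,\epsilon)$ is the open ball of center $x$ and radius $\epsilon$. A sequence $\{K_n\}$ of subsets of $X$ is decreasing if $K_{n+1}\subset K_n$ for all $n\in\mathbb N$ (not necessarily strictly). For $A\subset X$, $\hat d(A)=\sup_{x\in A} d(x,X\setminus A)$, where $d(x,B)=\inf_{y\in B}d(x,y)$ for nonempty $B\subset X$, and by convention $d(x,\emptyset)=\sup\{d(x,B):\emptyset\ne B\subset X\}=\sup_{y\in X}d(x,y)$ (relevant only when $A=X$). *)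

(* Defs.v *)
From mathcomp Require Import all_boot all_order all_algebra.
From mathcomp Require Import all_classical all_reals all_analysis.

Set Implicit Arguments.
Unset Strict Implicit.
Unset Printing Implicit Defensive.

Import Order.TTheory GRing.Theory Num.Theory.
Import numFieldNormedType.Exports.

Local Open Scope classical_set_scope.
Local Open Scope ring_scope.

Section AtsujiSpaces.
Context {R : realType}.

Definition uniformly_discrete (X : metricType R) (A : set X) : Prop :=
  exists2 eta : R, 0 < eta &
    forall x y, A x -> A y -> x <> y -> eta <= mdist x y.

(* [ball x e] is the open ball [set y | mdist x y < e] (lemma [ballEmdist]). *)
Definition open_neighborhood (X : metricType R) (A : set X) (eps : R) : set X :=
  \bigcup_(x in A) ball x eps.

Definition atsuji (X : metricType R) : Prop :=
  compact (limit_point [set: X]) /\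
  forall eps : R, 0 < eps ->
    uniformly_discrete (~` open_neighborhood (limit_point [set: X]) eps).

Definition metric_bounded (X : metricType R) (A : set X) : Prop :=
  exists M : R, forall x y, A x -> A y -> mdist x y <= M.

Definition dist_inf (X : metricType R) (x : X) (B : set X) : \bar R :=
  ereal_inf [set (mdist x y)%:E | y in B].

(* The infimum over the empty set would be +oo, hence the case distinction:
   by convention d(x, set0) is the supremum of the distances from x to the
   nonempty sets. Values are extended reals since that supremum is +oo when
   the space is unbounded. *)
Definition dist_to_set (X : metricType R) (x : X) (B : set X) : \bar R :=
  if `[< B = set0 >]
  then ereal_sup [set dist_inf x C | C in [set C : set X | C !=set0]]
  else dist_inf x B.

Definition dhat (X : metricType R) (A : set X) : \bar R :=
  ereal_sup [set dist_to_set x (~` A) | x in A].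

Lemma dist_to_set0 (X : metricType R) (x : X) :
  dist_to_set x set0 = ereal_sup [set (mdist x y)%:E | y in [set: X]].
Proof.
rewrite /dist_to_set asboolT//; apply/eqP; rewrite eq_le; apply/andP; split.
- apply: ge_ereal_sup => _ [C [y Cy] <-].
  apply: (@le_trans _ _ (mdist x y)%:E).
    by apply: ereal_inf_lbound; exists y.
  by apply: ereal_sup_ubound; exists y.
- apply: ge_ereal_sup => _ [y _ <-].
  apply: ereal_sup_ubound; exists [set y]; first by exists y.
  by rewrite /dist_inf image_set1 ereal_inf1.
Qed.

End AtsujiSpaces.

(* Main.v *)
(** If every [K n] comes arbitrarily close to the compact set [X'] of limit
    points, a cluster point of approximating points of [X'] lies in all the
    [K n]. Otherwise some [K N] stays at distance [eps] from [X']; a point of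
    [K N] is then at distance at least [min (eps / 2) eta] from every other
    point of [X], where [eta] is the separation constant outside the
    [eps / 2]-neighborhood of [X']. Hence [dhat (K n)] is bounded away from
    [0] for large [n], unless all the [K n] are equal to [X]. *)
Require Import Defs.
From mathcomp Require Import all_boot all_order all_algebra.
From mathcomp Require Import all_classical all_reals all_analysis.
From mathcomp Require Import lra.

Import Order.TTheory GRing.Theory Num.Theory.

Local Open Scope classical_set_scope.
Local Open Scope ring_scope.

Lemma bigcap_closed_near_compact {R : realType} {X : metricType R}
    {A : set X} {K : nat -> set X} :
  compact A ->
  (forall m n, (m <= n)%N -> K n `<=` K m) ->
  (forall n, closed (K n)) ->
  (forall n (eps : R), 0 < eps -> K n `&` open_neighborhood A eps !=set0) ->
  \bigcap_n K n !=set0.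
Proof.
move=> cA decK clK nearK.
have /choice[w wP] : forall n, exists w : X * X,
    [/\ K n w.1, A w.2 & ball w.2 n.+1%:R^-1 w.1].
  move=> n; have [|x [Kx [z Az zx]]] := nearK n n.+1%:R^-1.
    by rewrite invr_gt0.
  by exists (x, z).
have [|p [_ clp]] := cA ((snd \o w) @ \oo) _ _.
  by exists 0%N => // n _ /=; have [] := wP n.
exists p => n _; apply: clK => B /nbhs_ballP[e /= e0 eB].
have e20 : 0 < e / 2 by rewrite divr_gt0.
(* Clustering at [p] is tested on a tail: [n <= m] puts [(w m).1] in [K n], and the bound [e / 2] on
   both halves of the path from [p] through [(w m).2] keeps it in [ball p e]. *)
have [||q [[m [nm me <-]] pq]] := clp ((snd \o w) @`
    [set m | (n <= m)%N /\ m.+1%:R^-1 < e / 2]) (ball p (e / 2)).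
- change (\forall m \near \oo, ((snd \o w) @` [set i | (n <= i)%N /\
    i.+1%:R^-1 < e / 2]) ((snd \o w) m)).
  near=> m; exists m => //=; split.
    by near: m; exact: nbhs_infty_ge.
  by near: m; exact: near_infty_natSinv_lt (PosNum e20).
- exact: nbhsx_ballx.
have [Kw _ bw] := wP m.
exists (w m).1; split; first exact: decK nm _ Kw.
apply/eB/(@ball_split _ _ (w m).2) => //.
exact: le_ball (ltW me) _ bw.
Unshelve. all: by end_near. Qed.

(** If [y] is within [eps / 2] of a limit point, the triangle inequality gives [eps / 2]; otherwise
    [x] and [y] both avoid the [eps / 2]-neighborhood, where [eta] applies. *)
Lemma atsuji_isolation {R : realType} {X : metricType R} {A : set X}
    {eps : R} :
  atsuji X -> 0 < eps ->
  A `&` open_neighborhood (limit_point [set: X]) eps = set0 ->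
  exists2 c : R, 0 < c & forall x y, A x -> x <> y -> c <= mdist x y.
Proof.
move=> [_ discX] eps0 A0.
have e20 : 0 < eps / 2 by rewrite divr_gt0.
have [eta eta0 etaP] := discX _ e20.
exists (Num.min (eps / 2) eta); first by rewrite lt_min e20.
move=> x y Ax xy; rewrite ge_min.
have far z : limit_point [set: X] z -> ball z eps x -> False.
  by move=> Lz zx; rewrite -[False]/(set0 x) -A0; split => //; exists z.
have [[z Lz zy]|Ny] := pselect (open_neighborhood (limit_point [set: X])
    (eps / 2) y).
  apply/orP; left; rewrite leNgt; apply/negP => dxy; apply: (far z Lz).
  apply: ball_split zy _.
  by rewrite ballEmdist /= metric_sym.
apply/orP; right; apply: etaP => // -[z Lz zx]; apply: (far z Lz).
by apply: le_ball zx; lra.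
Qed.

Lemma dhat_ge (R : realType) (X : metricType R) (A : set X) (c : R) :
  A !=set0 -> ~` A !=set0 ->
  (forall x y, A x -> ~ A y -> c <= mdist x y) ->
  (c%:E <= dhat A)%E.
Proof.
move=> [x Ax] /set0P/eqP NA cA.
apply: (@le_trans _ _ (dist_to_set x (~` A))); last first.
  by apply: ereal_sup_ubound; exists x.
rewrite /dist_to_set asboolF//; apply: le_ereal_inf_tmp => _ [y Ay <-].
by rewrite lee_fin; exact: cA.
Qed.

Theorem theorem4p3 (R : realType) (X : metricType R) (K : nat -> set X) :
  atsuji X ->
  (forall n, K n.+1 `<=` K n) ->
  (forall n, K n !=set0) ->
  (forall n, closed (K n)) ->
  (forall n, metric_bounded (K n)) ->
  dhat (K n) @[n --> \oo] --> 0%E ->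
  \bigcap_n K n !=set0.
Proof.
move=> aX KS K0 clK _ dK.
have decK m n : (m <= n)%N -> K n `<=` K m.
  move=> /subnK <-; elim: (n - m)%N => [//|k IH].
  by rewrite addSn; exact: subset_trans (KS _) IH.
have [nearK|] := pselect (forall n (eps : R), 0 < eps ->
    K n `&` open_neighborhood (limit_point [set: X]) eps !=set0).
  by apply: bigcap_closed_near_compact nearK => //; case: aX.
move=> /existsNP[N /existsNP[eps /not_implyP[eps0 /set0P/negP/negPn/eqP KN0]]].
have [c c0 cP] := atsuji_isolation aX eps0 KN0.
(* If every [K n] is [X], any point will do; this case is split off because [dhat_ge] needs a
   nonempty complement. *)
have [KT|/existsNP[M KM]] := pselect (forall n, ~ (~` K n !=set0)).
  have [x _] := K0 0%N; exists x => n _.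
  by apply: contrapT => Kx; apply: (KT n); exists x.
move/contrapT : KM => [y KMy]; exfalso.
have : (c%:E <= 0)%E; last by rewrite lee_fin leNgt c0.
(* For [n >= M] the point [y] stays outside [K n]; for [n >= N] the separation [c] holds on
   [K n]. *)
apply: (cvge_to_ge dK); near=> n.
apply: dhat_ge => //.
  exists y => Kny; apply: KMy; apply: decK Kny.
  by near: n; exact: nbhs_infty_ge.
move=> u v Ku Kv; apply: cP; last by move=> uv; apply: Kv; rewrite -uv.
apply: decK Ku; near: n; exact: nbhs_infty_ge.
Unshelve. all: by end_near. Qed.
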